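(* Let $\lambda$ be a Young diagram and fix a function $g:\mathbb Z_{\ge0}^2\to\mathbb R_{\ge 0}$. For $(i,j)\in\lambda$ define $$\psi(i,j)=\sum_{\substack{(p,q)\in\mathbb Z_{\ge0}^2\\ (i+p,\,j+q)\in\lambda}} g(p,q),\qquad \psi^\ast(i,j)=\sum_{\substack{(p,q)\in\mathbb Z_{\ge0}^2\\ (i-p,\,j-q)\in\lambda}} g(p,q).$$ Let $\Psi\langle\lambda,g\rangle=\{\psi(i,j):(i,j)\in\lambda\}$ and $\Psi^\ast\langle\lambda,g\rangle=\{\psi^\ast(i,j):(i,j)\in\lambda\}$ (as multisets). Then $\Psi\langle\lambda,g\rangle$ majorizes $\Psi^\ast\langle\lambda,g\rangle$.
   Context: Let $\lambda=(\lambda_1\ge\dots\ge\lambda_\ell>0)$ be an integer partition; its Young diagram is the set of squares $(i,j)$ with $1\le i\le\ell$, $1\le j\le\lambda_i$. Majorization: for two multisets $\mathcal A,\mathcal B$ of $n$ real numbers, let $a_1\ge\dots\ge a_n$ and $b_1\ge\dots\ge b_n$ be their elements in non-increasing order. $\mathcal A$ majorizes $\mathcal B$ if $a_1+\dots+a_k\ge b_1+\dots+b_k$ for all $1\le k<n$ and $a_1+\dots+a_n=b_1+\dots+b_n$. *)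

(* Defs.v *)
From mathcomp Require Import all_boot all_order all_algebra.
From mathcomp Require Import all_classical reals.

Set Implicit Arguments.
Unset Strict Implicit.
Unset Printing Implicit Defensive.

Import Order.TTheory GRing.Theory Num.Theory.
Local Open Scope ring_scope.
Local Open Scope classical_set_scope.

Definition is_partition (la : seq nat) : bool :=
  sorted geq la && all (fun m => 0 < m)%N la.

(* Squares (i, j) are indexed from 1, so row i has length nth 0 la i.-1. *)
Definition young (la : seq nat) : seq (nat * nat) :=
  [seq (i, j) | i <- iota 1 (size la), j <- iota 1 (nth 0%N la i.-1)].

Lemma mem_young la i j :
  ((i, j) \in young la) =
  (1 <= i <= size la)%N && (1 <= j <= nth 0%N la i.-1)%N.
Proof.
apply/allpairsPdep/idP => [[x [y [hx hy [-> ->]]]]|/andP[hi hj]].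
  by move: hx hy; rewrite !mem_iota !add1n !ltnS => -> ->.
by exists i, j; rewrite !mem_iota !add1n !ltnS.
Qed.

Lemma young_uniq la : uniq (young la).
Proof.
apply: allpairs_uniq_dep => [|x _|]; try exact: iota_uniq.
by move=> [a b] [c d] /= _ _ [-> ->].
Qed.

Section Psi.
Variables (R : realType) (la : seq nat) (g : nat * nat -> R).

(* The index sets below are finite (see the two lemmas after the section), so
   the finitely-supported sums never take their default value. *)
Definition psi (c : nat * nat) : R :=
  \sum_(d \in [set d : nat * nat | (c.1 + d.1, c.2 + d.2)%N \in young la]) g d.

(* Subtraction is truncated, which is harmless: no square of the diagram has a
   zero coordinate. *)
Definition psi_star (c : nat * nat) : R :=
  \sum_(d \in [set d : nat * nat | (c.1 - d.1, c.2 - d.2)%N \in young la]) g d.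

Definition Psi : seq R := [seq psi c | c <- young la].

Definition Psi_star : seq R := [seq psi_star c | c <- young la].

End Psi.

Lemma psi_index_finite la (c : nat * nat) :
  finite_set [set d : nat * nat | (c.1 + d.1, c.2 + d.2)%N \in young la].
Proof.
apply: (@sub_finite_set _ _
  [set` [seq (x.1 - c.1, x.2 - c.2)%N | x <- young la]]) => [[p q] /= h|];
  last exact: finite_seq.
by apply/mapP; exists (c.1 + p, c.2 + q)%N; rewrite //= !addKn.
Qed.

Lemma psi_star_index_finite la (c : nat * nat) :
  finite_set [set d : nat * nat | (c.1 - d.1, c.2 - d.2)%N \in young la].
Proof.
apply: (@sub_finite_set _ _
  [set` [seq (c.1 - x.1, c.2 - x.2)%N | x <- young la]]) => [[p q] /= h|];
  last exact: finite_seq.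
apply/mapP; exists (c.1 - p, c.2 - q)%N => //=.
move: h; rewrite mem_young => /andP[/andP[h1 _] /andP[h2 _]].
by rewrite !subKn //; apply: ltnW; rewrite -subn_gt0.
Qed.

(* Multisets of reals are represented by sequences; sorting makes the relation
   independent of the order in which the elements are listed. *)
Definition majorizes (R : realType) (A B : seq R) : Prop :=
  let a := sort >=%R A in
  let b := sort >=%R B in
  [/\ size A = size B,
      forall k, (1 <= k < size A)%N ->
        \sum_(i < k) b`_i <= \sum_(i < k) a`_i
    & \sum_(i < size A) a`_i = \sum_(i < size B) b`_i].

(* Main.v *)
(** Given a set [A] of squares of the diagram, push its squares up inside their
    columns, then left inside their rows, to get a set [B] of squares of the
    diagram with the same cardinality. For every [(p, q)], the number of squares
    of [A] that stay in the diagram when moved by [(-p, -q)] is at most the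
    number of squares of [B] that stay in the diagram when moved by [(p, q)]:
    if [n] squares of a line have a position greater than [p], then the last of
    them has a position at least [n + p], so the first [n] squares of the line
    can all be moved forward by [p]. As [B] does not depend on [(p, q)],
    weighting by [g] bounds the sum of [psi^*] over [A] by the sum of [psi] over
    [B]. Taking for [A] the squares with the largest values of [psi^*] gives the
    majorization inequalities; the totals agree because moving by [(p, q)] is a
    bijection between the two sets of squares that are counted. *)

Require Import Defs.
From mathcomp Require Import all_boot all_order all_algebra zify.
From mathcomp Require Import all_classical reals.

Set Implicit Arguments.
Unset Strict Implicit.
Unset Printing Implicit Defensive.

Import Order.TTheory GRing.Theory Num.Theory.
Local Open Scope ring_scope.

Lemma sum_nth_take (V : nmodType) (s : seq V) k : (k <= size s)%N ->
  \sum_(i < k) s`_i = \sum_(x <- take k s) x.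
Proof.
move=> ks; rewrite (big_nth 0) size_takel // big_mkord.
by apply: eq_bigr => i _; rewrite nth_take.
Qed.

Lemma sum_subseq_le_take (R : numDomainType) (s t : seq R) :
  sorted >=%R s -> subseq t s ->
  \sum_(x <- t) x <= \sum_(x <- take (size t) s) x.
Proof.
elim: s t => [|x s IHs] [|y t] // s_sorted t_sub.
have y_le_x : y <= x.
  have /allP s_le_x := order_path_min ge_trans s_sorted.
  have := mem_subseq t_sub (mem_head y t).
  by rewrite inE => /orP[/eqP-> //|/s_le_x].
rewrite /= !big_cons lerD // IHs ?(path_sorted s_sorted) //; move: t_sub => /=.
by case: eqP => // _; apply/subseq_trans/subseq_cons.
Qed.

Section SumSort.
Variables (R : realDomainType) (T : eqType).
Implicit Types (s A B : seq T) (f : T -> R).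

Lemma sum_le_sum_sort f s B : uniq B -> {subset B <= s} ->
  \sum_(x <- B) f x <= \sum_(i < size B) (sort >=%R (map f s))`_i.
Proof.
move=> B_uniq B_sub.
have [t t_sub B_t] :
    exists2 t, subseq t (sort >=%R (map f s)) & perm_eq (map f B) t.
  apply/count_subseqP => x; rewrite count_sort !count_map.
  have [u u_sub /seq.permP->] : exists2 u, subseq u s & perm_eq B u.
    exact/count_subseqP/leq_uniq_count.
  exact: leq_count_subseq.
have size_t : size t = size B by rewrite -(perm_size B_t) size_map.
rewrite -(big_map f xpredT id) (perm_big _ B_t) -size_t.
rewrite sum_nth_take ?size_subseq //.
by apply: sum_subseq_le_take => //; apply/sort_sorted => x y; apply: le_total.
Qed.

Lemma sum_sort_attained f s k : uniq s -> (k <= size s)%N ->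
  exists A, [/\ uniq A, {subset A <= s}, size A = k &
    \sum_(i < k) (sort >=%R (map f s))`_i = \sum_(x <- A) f x].
Proof.
move=> s_uniq ks; exists (take k (sort (relpre f >=%R) s)); split.
- by rewrite take_uniq // sort_uniq.
- by move=> x /mem_take; rewrite mem_sort.
- by rewrite size_takel // size_sort.
by rewrite sum_nth_take ?size_sort ?size_map // sort_map -map_take big_map.
Qed.

Lemma sum_sort f s :
  \sum_(i < size s) (sort >=%R (map f s))`_i = \sum_(x <- s) f x.
Proof.
rewrite sum_nth_take ?take_oversize ?size_sort ?size_map //.
by rewrite -(big_map f xpredT id); apply: perm_big; rewrite perm_sort.
Qed.

End SumSort.

Lemma majorizes_map (R : realType) (T : eqType) (f h : T -> R) (s : seq T) :
  uniq s ->
  (forall A : seq T, uniq A -> {subset A <= s} -> exists B,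
    [/\ uniq B, {subset B <= s}, size B = size A &
        \sum_(x <- A) h x <= \sum_(x <- B) f x]) ->
  \sum_(x <- s) f x = \sum_(x <- s) h x ->
  majorizes (map f s) (map h s).
Proof.
move=> s_uniq h_le_f eq_total; split; rewrite ?size_map ?sum_sort // => k.
case/andP=> _ /ltnW ks.
have [A [A_uniq A_sub A_size ->]] := sum_sort_attained h s_uniq ks.
have [B [B_uniq B_sub B_size hA_le_fB]] := h_le_f A A_uniq A_sub.
by rewrite (le_trans hA_le_fB) // -A_size -B_size sum_le_sum_sort.
Qed.

Lemma count_sum (T : Type) (P : pred T) (s : seq T) :
  count P s = (\sum_(x <- s) P x)%N.
Proof. by rewrite -sumn_count sumnE big_map. Qed.

Lemma sum_fsbig_count (V : nmodType) (T : eqType) (U : choiceType)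
    (r : T -> pred U) (g : U -> V) (L : seq U) (A : seq T) :
  uniq L -> {in A, forall c, {subset r c <= L}} ->
  \sum_(c <- A) \sum_(d \in [set d | r c d]%classic) g d =
  \sum_(d <- L) g d *+ count (r^~ d) A.
Proof.
move=> L_uniq r_sub; transitivity (\sum_(c <- A) \sum_(d <- L) g d *+ r c d).
  apply: eq_big_seq => c cA; under [RHS]eq_bigr do rewrite mulrb.
  rewrite -big_mkcond -big_filter [RHS]fsbig_seq ?filter_uniq //.
  apply: eq_fsbigl; apply/seteqP; split=> d /=; rewrite mem_filter => rcd.
    by rewrite rcd (r_sub c).
  by case/andP: rcd.
rewrite exchange_big; apply: eq_bigr => d _.
by rewrite sumrMnr count_sum.
Qed.

Lemma leq_count_fibres (T I : eqType) (line : T -> I) (P Q : pred T)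
    (s t : seq T) :
  (forall y, count [pred c | P c & line c == y] s <=
             count [pred c | Q c & line c == y] t)%N ->
  (count P s <= count Q t)%N.
Proof.
move=> le_fibre; rewrite -!size_filter.
rewrite -(size_map line) -[leqRHS](size_map line).
have [u u_sub /perm_size->] :
    exists2 u, subseq u [seq line c | c <- t & Q c] &
      perm_eq [seq line c | c <- s & P c] u.
  apply/count_subseqP => y; rewrite !count_map !count_filter.
  have := le_fibre y; congr leq; apply: eq_count => c /=; exact: andbC.
exact: size_subseq.
Qed.

Lemma exists_geq_of_count (u : seq nat) p n :
  uniq u -> (n < count (leq p) u)%N -> exists2 x, x \in u & (n + p <= x)%N.
Proof.
move=> u_uniq; rewrite -size_filter => n_lt; apply/hasP; apply: contraTT n_lt.
move=> /hasPn u_small; rewrite -leqNgt -(size_iota p n).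
apply: uniq_leq_size; first exact: filter_uniq.
by move=> x; rewrite mem_filter mem_iota => /andP[? /u_small]; lia.
Qed.

Section Push.
Variables (T I : eqType).
Variables (line : T -> I) (pos : T -> nat) (cell : I -> nat -> T).
Hypothesis cellK : forall c, cell (line c) (pos c) = c.
Hypothesis line_cell : forall y t, line (cell y t) = y.
Hypothesis pos_cell : forall y t, pos (cell y t) = t.

(* Positions start at 1, as in [young]: position 0 is unconstrained. *)
Definition initial (P : pred T) : Prop :=
  forall y t t', (0 < t' <= t)%N -> P (cell y t) -> P (cell y t').

Variable D : seq T.
Hypothesis D_uniq : uniq D.
Hypothesis D_pos : {in D, forall c, 0 < pos c}%N.
Hypothesis D_initial : initial (mem D).

Definition line_size (A : seq T) (y : I) : nat :=
  count (fun c => line c == y) A.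

Definition push (A : seq T) : seq T :=
  [seq c <- D | (pos c <= line_size A (line c))%N].

Implicit Types (A : seq T) (P : pred T).

Lemma push_uniq A : uniq (push A).
Proof. exact: filter_uniq. Qed.

Lemma push_sub A : {subset push A <= D}.
Proof. by move=> c; rewrite mem_filter => /andP[]. Qed.

Lemma initial_cell_of_count P A p y t : uniq A -> initial P ->
  (0 < t <= count [pred c | (p < pos c)%N && P c & line c == y] A)%N ->
  P (cell y (t + p)).
Proof.
move=> A_uniq P_initial /andP[t_gt0 t_le].
pose u := [seq pos c | c <- A & P c && (line c == y)].
have u_uniq : uniq u.
  rewrite map_inj_in_uniq ?filter_uniq // => c c'; rewrite !mem_filter.
  move=> /andP[/andP[_ /eqP cy] _] /andP[/andP[_ /eqP c'y] _] eq_pos.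
  by rewrite -(cellK c) -(cellK c') cy c'y eq_pos.
have [|x /mapP[c]] := @exists_geq_of_count u p.+1 t.-1 u_uniq.
  rewrite prednK // count_map count_filter.
  by apply: leq_trans t_le _; apply/eq_leq/eq_count => c /=; rewrite andbA.
rewrite mem_filter => /andP[/andP[Pc /eqP cy] _] -> pos_ge.
by apply: (P_initial y (pos c)); [lia | rewrite -cy cellK].
Qed.

Lemma perm_push_line A y : uniq A -> {subset A <= D} ->
  perm_eq [seq c <- push A | line c == y]
          [seq cell y t | t <- iota 1 (line_size A y)].
Proof.
move=> A_uniq A_sub; apply: uniq_perm.
- by rewrite filter_uniq ?push_uniq.
- rewrite map_inj_uniq ?iota_uniq // => t t'.
  by move/(congr1 pos); rewrite !pos_cell.
move=> c; rewrite !mem_filter; apply/idP/mapP => [/and3P[/eqP<- pos_le cD]|[t]].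
  exists (pos c); last by rewrite cellK.
  by rewrite mem_iota add1n ltnS D_pos.
rewrite mem_iota add1n ltnS => t_le ->; rewrite line_cell pos_cell eqxx /=.
case/andP: (t_le) => _ -> /=; rewrite -[t in cell y t]addn0.
apply: (@initial_cell_of_count (mem D) A) => //.
suff -> : count [pred c | (0 < pos c)%N && (c \in D) & line c == y] A =
          line_size A y by [].
by apply: eq_in_count => c' /A_sub c'D /=; rewrite c'D D_pos.
Qed.

Lemma count_push_line A P y : uniq A -> {subset A <= D} ->
  count [pred c | P c & line c == y] (push A) =
  count (fun t => P (cell y t)) (iota 1 (line_size A y)).
Proof.
move=> A_uniq A_sub; rewrite -(count_map (cell y) P) -count_filter.
exact/seq.permP/perm_push_line.
Qed.

Lemma leq_count_push A P p : uniq A -> {subset A <= D} -> initial P ->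
  (count (fun c => (p < pos c) && P c) A <=
   count (fun c => P (cell (line c) (pos c + p))) (push A))%N.
Proof.
move=> A_uniq A_sub P_initial; apply: (leq_count_fibres (line := line)) => y.
rewrite count_push_line //; set n := count _ A.
under eq_count do rewrite line_cell pos_cell.
have n_le : (n <= line_size A y)%N by apply: sub_count => c /andP[].
have : all (fun t => P (cell y (t + p))) (iota 1 n).
  apply/allP => t; rewrite mem_iota add1n ltnS.
  exact: initial_cell_of_count.
rewrite all_count size_iota -(subnKC n_le) iotaD count_cat => /eqP->.
exact: leq_addr.
Qed.

Lemma size_push A : uniq A -> {subset A <= D} -> size (push A) = size A.
Proof.
move=> A_uniq A_sub; rewrite -(size_map line) -[RHS](size_map line).
apply/perm_size/allP => y _ /=; rewrite !count_map -size_filter.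
by rewrite (perm_size (perm_push_line y A_uniq A_sub)) size_map size_iota.
Qed.

End Push.

Definition forward_count (D : seq (nat * nat)) (d : nat * nat) :
  seq (nat * nat) -> nat := count (fun c => (c.1 + d.1, c.2 + d.2)%N \in D).

Definition backward_count (D : seq (nat * nat)) (d : nat * nat) :
  seq (nat * nat) -> nat := count (fun c => (c.1 - d.1, c.2 - d.2)%N \in D).

Section Diagram.
Variable D : seq (nat * nat).
Hypothesis D_uniq : uniq D.
Hypothesis D_pos : {in D, forall c, (0 < c.1) && (0 < c.2)}%N.

Lemma forward_backward_count (d : nat * nat) :
  forward_count D d D = backward_count D d D.
Proof.
have countE (f : nat * nat -> nat * nat) :
    count (fun c => f c \in D) D = (\sum_(c <- D) \sum_(x <- D) (x == f c))%N.
  rewrite count_sum; apply: eq_bigr => c _.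
  by rewrite -count_sum -count_uniq_mem.
rewrite /forward_count (countE (fun c => (c.1 + d.1, c.2 + d.2)%N)).
rewrite /backward_count (countE (fun c => (c.1 - d.1, c.2 - d.2)%N)).
rewrite exchange_big.
apply: eq_big_seq => x xD; apply: eq_big_seq => c cD; congr nat_of_bool.
case: x c xD cD => [i j] [i' j'] /D_pos/= ij_gt0 /D_pos/= ij'_gt0.
by rewrite !xpair_eqE /=; lia.
Qed.

Hypothesis D_lower : forall i j i' j', (0 < i' <= i)%N -> (0 < j' <= j)%N ->
  (i, j) \in D -> (i', j') \in D.

Let row_cell (i j : nat) : nat * nat := (i, j).
Let column_cell (j i : nat) : nat * nat := (i, j).

Lemma initial_rows : initial row_cell (mem D).
Proof.
move=> i j j' j'_le ijD; have /andP[/= i_gt0 _] := D_pos ijD.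
by apply: D_lower ijD; rewrite ?i_gt0 /=.
Qed.

Lemma initial_columns : initial column_cell (mem D).
Proof.
move=> j i i' i'_le ijD; have /andP[_ /= j_gt0] := D_pos ijD.
by apply: D_lower ijD; rewrite ?j_gt0 /=.
Qed.

Definition push_left : seq (nat * nat) -> seq (nat * nat) := push fst snd D.

Definition push_up : seq (nat * nat) -> seq (nat * nat) := push snd fst D.

Section PushUpLeft.
Variable A : seq (nat * nat).
Hypotheses (A_uniq : uniq A) (A_sub : {subset A <= D}).

Lemma size_push_left : size (push_left A) = size A.
Proof.
apply: (size_push (cell := row_cell)) => // [[] //|c /D_pos/andP[] //|].
exact: initial_rows.
Qed.

Lemma size_push_up : size (push_up A) = size A.
Proof.
apply: (size_push (cell := column_cell)) => // [[] //|c /D_pos/andP[] //|].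
exact: initial_columns.
Qed.

Lemma leq_count_push_left P q : initial row_cell P ->
  (count (fun c => (q < c.2) && P c) A <=
   count (fun c => P (c.1, c.2 + q)) (push_left A))%N.
Proof.
apply: leq_count_push => // [[] //|c /D_pos/andP[] //|].
exact: initial_rows.
Qed.

Lemma leq_count_push_up P p : initial column_cell P ->
  (count (fun c => (p < c.1) && P c) A <=
   count (fun c => P (c.1 + p, c.2)) (push_up A))%N.
Proof.
apply: leq_count_push => // [[] //|c /D_pos/andP[] //|].
exact: initial_columns.
Qed.

End PushUpLeft.

Lemma exists_compression (A : seq (nat * nat)) : uniq A -> {subset A <= D} ->
  exists B, [/\ uniq B, {subset B <= D}, size B = size A &
    forall d : nat * nat, (backward_count D d A <= forward_count D d B)%N].
Proof.
move=> A_uniq A_sub.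
have up_uniq : uniq (push_up A) by apply: push_uniq.
have up_sub : {subset push_up A <= D} by apply: push_sub.
exists (push_left (push_up A)); split=> [|||[p q]].
- exact: push_uniq.
- exact: push_sub.
- by rewrite size_push_left ?size_push_up.
have backward_le : (backward_count D (p, q) A <=
    count (fun c => (p < c.1) && ((q < c.2) && (c \in D))) A)%N.
  rewrite /backward_count -!size_filter.
  apply: uniq_leq_size; first exact: filter_uniq.
  move=> c; rewrite !mem_filter => /andP[cD cA]; rewrite cA A_sub // !andbT.
  by have := D_pos cD; rewrite !subn_gt0.
apply: (leq_trans backward_le).
apply: leq_trans (leq_count_push_up A_uniq A_sub p _) _.
  by move=> j i i' i'_le /= /andP[-> ijD]; apply: initial_columns ijD.
pose moved_down := [pred c : nat * nat | (c.1 + p, c.2)%N \in D].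
apply: (leq_count_push_left up_uniq up_sub (P := moved_down)) => i j j' j'_le.
exact: initial_rows.
Qed.

End Diagram.

Lemma young_gt0 la : {in young la, forall c, (0 < c.1) && (0 < c.2)}%N.
Proof.
by case=> i j; rewrite mem_young /= => /andP[/andP[-> _] /andP[-> _]].
Qed.

Lemma young_lower la i j i' j' : is_partition la ->
  (0 < i' <= i)%N -> (0 < j' <= j)%N ->
  (i, j) \in young la -> (i', j') \in young la.
Proof.
move=> /andP[la_sorted _] i'_le j'_le; rewrite !mem_young => /andP[i_le j_le].
have nth_le : (nth 0 la i.-1 <= nth 0 la i'.-1)%N.
  by apply: (sorted_leq_nth (rev_trans leq_trans) leqnn) la_sorted _ _ _ _ _;
    rewrite ?inE; lia.
lia.
Qed.

Definition differences (D : seq (nat * nat)) : seq (nat * nat) :=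
  undup [seq (x.1 - y.1, x.2 - y.2)%N | x <- D, y <- D].

Section SumPsi.
Variables (R : realType) (la : seq nat) (g : nat * nat -> R).

Lemma sum_psi (B : seq (nat * nat)) : {subset B <= young la} ->
  \sum_(c <- B) psi la g c = \sum_(d <- differences (young la))
    g d *+ forward_count (young la) d B.
Proof.
move=> B_sub; apply: sum_fsbig_count => [|c /B_sub cD [p q] cpqD].
  exact: undup_uniq.
rewrite mem_undup; apply/allpairsP.
by exists ((c.1 + p, c.2 + q)%N, c); rewrite /= !addKn.
Qed.

Lemma sum_psi_star (A : seq (nat * nat)) : {subset A <= young la} ->
  \sum_(c <- A) psi_star la g c = \sum_(d <- differences (young la))
    g d *+ backward_count (young la) d A.
Proof.
move=> A_sub; apply: sum_fsbig_count => [|c /A_sub cD [p q] cpqD].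
  exact: undup_uniq.
rewrite mem_undup; apply/allpairsP.
exists (c, (c.1 - p, c.2 - q)%N); split=> //=.
have := young_gt0 cpqD; rewrite /= !subn_gt0 => /andP[/ltnW p_le /ltnW q_le].
by rewrite !subKn.
Qed.

End SumPsi.

Theorem theorem4p1 (R : realType) (la : seq nat) (g : nat * nat -> R)
  (hla : is_partition la) (hg : forall d : nat * nat, 0 <= g d) :
  majorizes (Psi la g) (Psi_star la g).
Proof.
apply: majorizes_map => [|A A_uniq A_sub|].
- exact: young_uniq.
- have [i j i' j'|B [B_uniq B_sub B_size A_le_B]] :=
      exists_compression (young_uniq la) (@young_gt0 la) _ A_uniq A_sub.
    exact: young_lower.
  exists B; split=> //; rewrite sum_psi // sum_psi_star //.
  by apply: ler_sum => d _; rewrite ler_wpMn2l.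
rewrite sum_psi // sum_psi_star //; apply: eq_bigr => d _.
by rewrite forward_backward_count ?young_uniq //; apply: young_gt0.
Qed.
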